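(* Let $G$ be a topological group, let $X$ be a nonempty compact Hausdorff space, and let $\alpha \colon G \times X \to X$ be a continuous action of $G$ on $X$. If $S \subseteq G$ is a compact generating set for $G$ and $\eta(\alpha,S) = 0$, then $\alpha$ is amenable.
   Context: Topological groups are not assumed to be Hausdorff or locally compact. $\mathbb{N}$ is the set of natural numbers excluding $0$. A subset $S \subseteq G$ is said to generate $G$ if $S$ contains the neutral element $e_G$ of $G$ and $G = \bigcup_{n \in \mathbb{N}} S^{n}$, where $S^n = \{ s_1 \cdots s_n \mid s_1,\dots,s_n \in S\}$. A continuous action of $G$ on $X$ is a continuous map $\alpha \colon G \times X \to X$ (jointly continuous) with $\alpha(e_G,x) = x$ and $\alpha(gh,x) = \alpha(g,\alpha(h,x))$ for all $x \in X$, $g,h \in G$. Write $\alpha_g \colon X \to X$, $x \mapsto \alpha(g,x)$. Entropy. Let $\mathcal{C}(X)$ be the set of all finite open coverings of $X$, i.e., finite sets of open subsets of $X$ with union $X$. For sets $\mathcal{U},\mathcal{V}$ of subsets of $X$, $\mathcal{V}$ refines $\mathcal{U}$ if every $V \in \mathcal{V}$ is contained in some $U \in \mathcal{U}$. For $\mathcal{U},\mathcal{V} \in \mathcal{C}(X)$ and $S \subseteq G$, write $\mathcal{U} \preceq_S^{\alpha} \mathcal{V}$ if for every $g \in S$ the family $\{\alpha(g,V) \mid V \in \mathcal{V}\}$ (where $\alpha(g,V) = \{\alpha(g,x) \mid x \in V\}$) refines $\mathcal{U}$. For compact $S \subseteq G$ and $\mathcal{U} \in \mathcal{C}(X)$,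 put $$(S:\mathcal{U})_{\alpha} = \inf\{ |\mathcal{V}| \mid \mathcal{V} \in \mathcal{C}(X),\ \mathcal{U} \preceq_S^{\alpha} \mathcal{V} \}$$ (this is finite). For a compact generating subset $S$ of $G$, $$\eta(\alpha,S,\mathcal{U}) = \limsup_{n\to\infty} \frac{\log_2 (S^n:\mathcal{U})_{\alpha}}{n}, \qquad \eta(\alpha,S) = \sup\{\eta(\alpha,S,\mathcal{U}) \mid \mathcal{U} \in \mathcal{C}(X)\} \in [0,\infty].$$ Amenability. Let $C(X)$ be the space of continuous real-valued functions on $X$. A mean on $C(X)$ is a linear map $m \colon C(X) \to \mathbb{R}$ with $\inf_{x\in X} f(x) \leq m(f) \leq \sup_{x\in X} f(x)$ for all $f \in C(X)$. It is $\alpha$-invariant if $m(f) = m(f \circ \alpha_g)$ for all $f \in C(X)$ and $g \in G$. The action $\alpha$ is amenable if there exists an $\alpha$-invariant mean on $C(X)$. *)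

(* Defs.v *)
From HB Require Import structures.
From mathcomp Require Import all_boot all_order all_algebra finmap.
From mathcomp Require Import all_classical all_reals all_analysis.

Set Implicit Arguments.
Unset Strict Implicit.
Unset Printing Implicit Defensive.

Import Order.TTheory GRing.Theory Num.Theory.
Import numFieldNormedType.Exports.

Local Open Scope classical_set_scope.
Local Open Scope ring_scope.

HB.mixin Record isTopologicalGroup G & Topological G & Group G := {
  mulg_continuous : continuous (fun z : G * G => (z.1 * z.2)%g);
  invg_continuous : continuous (fun x : G => (x^-1)%g)
}.

#[short(type="topologicalGroupType")]
HB.structure Definition TopologicalGroup :=
  {G of Topological G & Group G & isTopologicalGroup G}.

Definition set_expg (G : groupType) (S : set G) (n : nat) : set G :=
  [set (\prod_(i < n) s i)%g | s in [set s : 'I_n -> G | forall i, S (s i)]].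

Definition generating (G : groupType) (S : set G) : Prop :=
  S 1%g /\ [set: G] = \bigcup_(n in [set n | (0 < n)%N]) set_expg S n.

Record continuous_action (G : topologicalGroupType) (X : topologicalType) := {
  action_fun :> G * X -> X;
  action_continuous : continuous action_fun;
  action1 : forall x, action_fun (1%g, x) = x;
  actionM : forall g h x,
    action_fun ((g * h)%g, x) = action_fun (g, action_fun (h, x))
}.

Section Translation.
Context (G : topologicalGroupType) (X : topologicalType).

Definition translation (a : continuous_action G X) (g : G) : X -> X :=
  fun x => a (g, x).

Lemma translation_continuous (a : continuous_action G X) (g : G) :
  continuous (translation a g).
Proof.
move=> x; apply: (@continuous_comp _ _ _ (fun y => (g, y)) a).
  exact: cvg_pair (cvg_cst _) cvg_id.
exact: action_continuous.
Qed.

HB.instance Definition _ (a : continuous_action G X) (g : G) :=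
  isContinuous.Build X X (translation a g) (@translation_continuous a g).

End Translation.

Section Entropy.
Context (R : realType) (G : topologicalGroupType) (X : topologicalType).
Implicit Types (S : set G) (U V : set (set X)).

Definition finite_open_cover U : Prop :=
  [/\ finite_set U, U `<=` open & \bigcup_(A in U) A = [set: X]].

Definition refines V U : Prop :=
  forall B, V B -> exists2 A, U A & B `<=` A.

Variable a : continuous_action G X.

Definition action_refines S U V : Prop :=
  forall g, S g -> refines [set translation a g @` B | B in V] U.

(* An extended real, so that the infimum of the empty set is +oo. *)
Definition covering_number S U : \bar R :=
  ereal_inf [set (#|` fset_set V|)%:R%:E
            | V in [set V | finite_open_cover V /\ action_refines S U V]].

Definition log2e (x : \bar R) : \bar R := (lne x * ((ln 2)^-1)%:E)%E.

(* The term of index 0, where n%:R^-1 = 0, does not affect the limsup. *)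
Definition cover_entropy S U : \bar R :=
  limn_esup (fun n => log2e (covering_number (set_expg S n) U)
                      * (n%:R^-1)%:E)%E.

Definition entropy S : \bar R :=
  ereal_sup [set cover_entropy S U | U in finite_open_cover].

End Entropy.

(* The codomain is R^o so that X -> R^o is an lmodule over R, from which the
   type of continuous functions inherits its pointwise lmodule structure. *)
Notation "{ 'ctsR' X -> R }" := (continuousType X R^o)
  (X at level 98, R at level 99).

Section RealContinuousFunctions.
Context (R : realType) (X : topologicalType).

Definition ctsR : {pred X -> R^o} := mem [set f : X -> R^o | continuous f].

Lemma ctsRP (f : {ctsR X -> R}) : (f : X -> R^o) \in ctsR.
Proof. by rewrite inE; exact: cts_fun. Qed.

Lemma ctsR_subK (f : X -> R^o) (cf : f \in ctsR) :
  continuous f.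
Proof. by move: cf; rewrite inE. Qed.

Definition ctsR_Sub (f : X -> R^o) (cf : f \in ctsR) : {ctsR X -> R} :=
  mkcts (ctsR_subK cf).

Lemma ctsR_rect (K : {ctsR X -> R} -> Type) :
  (forall f (cf : f \in ctsR), K (ctsR_Sub cf)) -> forall u, K u.
Proof.
move=> Ksub u.
have -> : u = ctsR_Sub (ctsRP u) by apply/continuousEP => x.
exact: Ksub.
Qed.

HB.instance Definition _ :=
  @isSub.Build (X -> R^o) (fun f => f \in ctsR) {ctsR X -> R}
    (@Continuous.sort X R^o) ctsR_Sub ctsR_rect (fun f cf => erefl).

Lemma ctsR_submod_closed : submod_closed ctsR.
Proof.
split; first by rewrite inE; exact: cst_continuous.
move=> c f g; rewrite !inE => cf cg x.
by apply: continuousD; [apply: continuousZr|]; [exact: cf|exact: cg].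
Qed.

HB.instance Definition _ :=
  GRing.isSubmodClosed.Build R (X -> R^o) ctsR ctsR_submod_closed.

HB.instance Definition _ :=
  [SubChoice_isSubLmodule of {ctsR X -> R} by <:].

End RealContinuousFunctions.

Section Amenability.
Context (R : realType) (G : topologicalGroupType) (X : topologicalType).

(* Used with X compact and nonempty, where the range of a continuous function
   is nonempty and bounded, so that the real-valued inf and sup are genuine. *)
Definition is_mean (m : {scalar {ctsR X -> R}}) : Prop :=
  forall f : {ctsR X -> R}, inf (range f) <= m f <= sup (range f).

Definition action_invariant (a : continuous_action G X) (m : {ctsR X -> R} -> R) :
    Prop :=
  forall (f : {ctsR X -> R}) (g : G), m f = m (f \o translation a g).

Definition amenable (a : continuous_action G X) : Prop :=
  exists m : {scalar {ctsR X -> R}}, is_mean m /\ action_invariant a m.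

End Amenability.

(* Main.v *)
Require Import Defs.
From HB Require Import structures.
From mathcomp Require Import all_boot all_order all_algebra finmap.
From mathcomp Require Import all_classical all_reals all_analysis.
From mathcomp Require Import ring lra.
Import Order.TTheory GRing.Theory Num.Theory.
Import numFieldNormedType.Exports.
Local Open Scope classical_set_scope.
Local Open Scope ring_scope.

(* Let U be a finite open cover on whose members finitely many given continuous
   functions oscillate by at most d, and let l and l' be covers of minimal
   cardinality with U <=_(S^n) l and U <=_(S^(n+1)) l'. For s in S, the translate
   s l' is again admissible for S^n. Hence, by minimality of l, any subfamily A
   of l has at most as many members as there are elements of s l' meeting a member
   of A. This is Hall's condition; a layer-cake comparison of counting functions
   turns it directly into a comparison of the sum of f over points chosen in the
   members of l with the sum of f o s over points chosen in the members of l', up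
   to an error 2 d |l'| + (|l'| - |l|) sup |f|, for every s in S including 1.
   Since the entropy vanishes, |l'| / |l| is arbitrarily close to 1 for suitable
   n, so the averages over the points of l' are almost invariant under S, and an
   ultrafilter limit of such averages is an invariant mean. *)

(** * Sums versus counting functions, ultrafilter limits, powers of a generating set *)

Lemma ler_sum_count {R : realDomainType} (r s : seq R) :
    (forall t, (count (>= t) r <= count (>= t) s)%N) -> {in s, forall y, 0 <= y} ->
  \sum_(x <- r) x <= \sum_(y <- s) y.
Proof.
have -> : \sum_(x <- r) x = \sum_(x <- sort >=%R r) x.
  by apply/perm_big; rewrite perm_sym perm_sort.
have countr t : count (>= t) r = count (>= t) (sort >=%R r).
  by apply/permP; rewrite perm_sym perm_sort.
move=> rs.
have {countr}{rs}: forall t, (count (>= t) (sort >=%R r) <= count (>= t) s)%N.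
  by move=> t; rewrite -countr.
move: (sort _ _) (sort_sorted ge_total r) => {}r; elim: r s => [|a r IH] s /=.
  by move=> _ _ s0; rewrite big_nil big_seq; apply: sumr_ge0.
move=> ar rs s0.
have ra : {in r, forall x, x <= a}.
  by move=> x; apply: (allP (order_path_min ge_trans ar)).
(* The hypothesis at [t = a] matches the largest entry [a] of [r] with some [b >= a] in [s]; both
   are then removed. *)
have [b bs ab] : exists2 b, b \in s & a <= b.
  by apply/hasP; rewrite has_count (leq_trans _ (rs a))//= lexx.
rewrite big_cons (perm_big _ (perm_to_rem bs)) big_cons lerD//.
apply: IH => [|t|y]; first exact: path_sorted ar; last first.
  by move/mem_rem/s0.
(* For [t <= a] both counts drop by one; for [t > a] no entry of [r] is counted. *)
have := rs t; rewrite (permP (perm_to_rem bs) (>= t)) /=.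
have [ta|ta _] := leP t a; first by rewrite (le_trans ta ab).
rewrite (_ : count _ r = 0)//; apply/eqP; rewrite -leqn0 leqNgt -has_count.
by apply/hasPn => x /ra xa; rewrite -ltNge (le_lt_trans xa).
Qed.

(** Compactness of [[- M, M]] yields a cluster point. It is a limit: the preimage of a neighbourhood
    or the complement of that preimage lies in [F], and the latter contradicts clustering. *)
Lemma ultra_cvg {R : realType} {T : Type} (F : set_system T) (f : T -> R) (M : R) :
  UltraFilter F -> (\forall m \near F, `|f m| <= M) -> cvg (f @ F).
Proof.
move=> UF fM; have PF : ProperFilter F by exact: ultra_proper.
have [p [_ pF]] : `[- M, M]%classic `&` cluster (f @ F) !=set0.
  apply: (@segment_compact R (- M) M); near=> m.
  by rewrite /= in_itv /= -ler_norml; near: m.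
apply/cvg_ex; exists p => B pB.
have [//|FB] := in_ultra_setVsetC (f @^-1` B) UF.
by have [y [nBy By]] := pF (~` B) B FB pB.
Unshelve. all: by end_near. Qed.

Lemma set_expg1 {G : groupType} (S : set G) n : S 1%g -> set_expg S n 1%g.
Proof. by move=> S1; exists (fun=> 1%g) => //; rewrite big1. Qed.

Lemma set_expgSr {G : groupType} (S : set G) n (g s : G) :
  set_expg S n g -> S s -> set_expg S n.+1 (g * s)%g.
Proof.
(* [insub] fails only at the last index [n], where the default [s] is used. *)
move=> [u Su <-] Ss; exists (fun i : 'I_n.+1 => oapp u s (insub (i : nat))) => /=.
  by move=> i; case: insubP => //= j _ _; exact: Su.
rewrite big_ord_recr /= insubF ?ltnn//=; congr (_ * _)%g.
by apply: eq_bigr => i _; rewrite /= insubT//= => ?; congr u; apply: val_inj.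
Qed.

(** * Continuous functions on a compact space *)

Section CompactSpace.
Context {R : realType} {X : topologicalType}.
Hypotheses (X_nonempty : [set: X] !=set0) (X_compact : compact [set: X]).

Lemma cts_bounded (f : {ctsR X -> R}) : exists M : R, forall x, `|f x| <= M.
Proof.
have [|c _ fc] := compact_EVT_max (f := fun x => `|f x| : R) X_nonempty X_compact.
  apply: continuous_subspaceT => x; apply: continuous_comp; first exact: cts_fun.
  exact: norm_continuous.
by exists `|f c| => x; apply: fc; rewrite inE.
Qed.

Lemma seq_cts_bounded (F : seq {ctsR X -> R}) :
  exists2 M : R, 0 < M & forall f x, f \in F -> `|f x| <= M.
Proof.
elim: F => [|f F [M M0 FM]]; first by exists 1.
have [N fN] := cts_bounded f; exists (Num.max N M).
  by rewrite lt_max M0 orbT.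
move=> g x; rewrite inE le_max => /predU1P[->|/FM ->]; rewrite ?fN ?orbT//.
Qed.

Lemma small_oscillation_cover (F : seq {ctsR X -> R}) (d : R) : 0 < d ->
  exists2 U, finite_open_cover U & forall f A x y,
    f \in F -> U A -> A x -> A y -> f x <= f y + d.
Proof.
move=> d0; have [x0 _] := X_nonempty.
(* Pointing [X] at [x0] keeps the topology and gives access to finite subcovers. *)
pose Y : ptopologicalType := HB.pack X (isPointed.Build X x0).
have : @cover_compact Y [set: Y] by rewrite -compact_cover.
(* Values on [O x] are within [d / 2] of [f x], hence within [d] of each other. *)
pose O (x : Y) := interior [set y | forall f, f \in F -> `|f x - f y| < d / 2].
have Ox x : O x x.
  rewrite /O /interior /=; elim: F {O} => [|f F IH].
    by apply: filterE => y g; rewrite in_nil.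
  have fx : \forall y \near x, `|f x - f y| < d / 2.
    apply: (@cvgrPdist_lt _ _ _ _ _ f (f x)).1; last by rewrite divr_gt0.
    exact: cts_fun.
  by apply: filterS2 fx IH => y fy IHy g; rewrite inE => /predU1P[->//|/IHy].
move=> /(_ X [set: X] O) [||D _ cD].
- by move=> x _; exact: open_interior.
- by move=> x _; exists x.
exists (O @` [set` D]).
  split; first by apply: finite_image; exact: finite_fset.
    by move=> _ [x _ <-]; exact: open_interior.
  by rewrite -subTset => x /cD[y Dy Oyx]; exists (O y).
move=> f _ x y Ff [z _ <-] /interior_subset/(_ f Ff) zx /interior_subset/(_ f Ff) zy.
by move: zx zy; rewrite !ltr_norml; lra.
Qed.

End CompactSpace.

(** * Minimal covers and Hall's condition *)

Section Covers.
Context {R : realType} {G : topologicalGroupType} {X : topologicalType}.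
Variable a : continuous_action G X.
Implicit Types (T S : set G) (U : set (set X)) (l : seq (set X)).

(** Covers are sequences, repetitions allowed, so that their members can be counted and summed
    over. *)
Definition admissible T U l :=
  finite_open_cover [set` l] /\ action_refines a T U [set` l].

Lemma minimal_cover T U : (covering_number R a T U < +oo)%E ->
  exists2 l, admissible T U l & covering_number R a T U = (size l)%:R%:E /\
    forall l', admissible T U l' -> (size l <= size l')%N.
Proof.
have seqV V : finite_open_cover V -> [set` fset_set V : seq (set X)] = V.
  by case=> fV _ _; exact: fset_setK.
case/ereal_inf_ltP => _ [V [oV rV] <-] _.
have exP : exists n, `[<exists2 l, admissible T U l & size l = n>].
  exists #|` fset_set V|; apply/asboolP.
  by exists (fset_set V) => //; rewrite /admissible seqV.
have [_ /asboolP[l ladm <-] lmin] := ex_minnP exP.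
exists l => //; split; last first.
  by move=> l' l'adm; apply: lmin; apply/asboolP; exists l'.
apply/eqP; rewrite eq_le; apply/andP; split.
  apply: (@le_trans _ _ (#|` fset_set [set` l]|)%:R%:E).
    by apply: ereal_inf_lbound; exists [set` l].
  rewrite lee_fin ler_nat (leq_trans _ (size_undup l))//.
  rewrite -(size_seq_fset tt) fsubset_leq_card//; apply/fsubsetP => B.
  by rewrite in_fset_set ?seq_fsetE ?inE//; case: ladm => -[].
apply: le_ereal_inf_tmp => _ [W [oW rW] <-]; rewrite lee_fin ler_nat.
apply: lmin; apply/asboolP.
by exists (fset_set W) => //; rewrite /admissible seqV.
Qed.

Lemma open_translation (g : G) (A : set X) : open A -> open (translation a g @` A).
Proof.
have trK h x : translation a h^-1%g (translation a h x) = x.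
  by rewrite /translation -actionM mulVg action1.
have -> : translation a g @` A = translation a g^-1%g @^-1` A.
  apply/seteqP; split=> [_ [x Ax <-]|x Ax]; first by rewrite /= trK.
  by exists (translation a g^-1%g x) => //; rewrite -{1}(invgK g) trK.
by apply: open_comp => x _; exact: translation_continuous.
Qed.

(* Replacing in the minimal cover l the sets satisfying P by the translates of
   the sets of l' satisfying Q yields again a cover admissible for T. *)
Lemma minimal_cover_count {T T' U l l'} (s : G) (P Q : pred (set X)) :
    (forall g, T g -> T' (g * s)%g) -> admissible T U l -> admissible T' U l' ->
    (forall k, admissible T U k -> (size l <= size k)%N) ->
    (forall w v, w \in l -> v \in l' -> P w ->
      w `&` translation a s @` v !=set0 -> Q v) ->
  (count P l <= count Q l')%N.
Proof.
move=> TT' [[_ ol cl] rl] [[_ ol' cl'] rl'] lmin PQ.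
pose k := [seq w <- l | ~~ P w] ++ [seq translation a s @` v | v <- l' & Q v].
have/lmin : admissible T U k.
  split; [split|].
  - exact: finite_seq.
  - move=> A; rewrite /k /= mem_cat mem_filter => /orP[/andP[_ /ol//]|].
    case/mapP => v; rewrite mem_filter => /andP[_ /ol' ov] ->.
    exact: open_translation.
  - rewrite -subTset => x _.
    have : [set: X] x by [].
    rewrite -cl => -[w lw wx].
    have [Pw|nPw] := boolP (P w); last first.
      by exists w => //=; rewrite mem_cat mem_filter nPw [w \in l]lw.
    (* The translate [s v] containing [x] meets [w], so [Q v] holds and [s v] belongs to [k]. *)
    have : [set: X] (translation a s^-1%g x) by [].
    rewrite -cl' => -[v lv vx].
    have svx : (translation a s @` v) x.
      exists (translation a s^-1%g x) => //.
      by rewrite /translation -actionM mulgV action1.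
    exists (translation a s @` v) => //=; rewrite mem_cat; apply/orP; right.
    by apply: map_f; rewrite mem_filter (PQ w v)//; exists x.
  - move=> g Tg _ [B Bk <-]; move: Bk; rewrite /k /= mem_cat mem_filter.
    case/orP => [/andP[_ lB]|/mapP[v]]; first by apply: rl Tg _ _; exists B.
    rewrite mem_filter => /andP[_ lv] ->.
    (* Here [g (s v) = (g s) v] with [g s] in [T'], so admissibility of [l'] applies. *)
    have [|A UA gsvA] := rl' _ (TT' _ Tg) (translation a (g * s)%g @` v).
      by exists v.
    exists A => // _ [_ [x vx <-] <-]; apply: gsvA; exists x => //.
    exact: actionM.
rewrite /k size_cat size_map !size_filter -(count_predC P l) addnC.
by rewrite leq_add2l.
Qed.

(** Counting is applied to superlevel sets. If [w] meets [s v] at [x], both lie in members of [U],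
    since [1] is in [T] and [s] in [T']; two oscillation bounds through [x] give
    [f (pt w) <= f (s (pt v)) + 2 d]. *)
Lemma sum_cover_le {T T' U l l'} (s : G) (pt : set X -> X) (f : X -> R) (d : R) :
    T 1%g -> (forall g, T g -> T' (g * s)%g) ->
    admissible T U l -> admissible T' U l' ->
    (forall k, admissible T U k -> (size l <= size k)%N) ->
    (forall A, A !=set0 -> A (pt A)) ->
    (forall A x y, U A -> A x -> A y -> f x <= f y + d) ->
    (forall x, 0 <= f x) -> 0 <= d ->
  \sum_(w <- l) f (pt w) <=
    \sum_(v <- l') f (translation a s (pt v)) + d *+ 2 *+ size l'.
Proof.
move=> T1 TT' adl adl' lmin ptP osc f0 d0.
have := @ler_sum_count R [seq f (pt w) | w <- l]
  [seq f (translation a s (pt v)) + d *+ 2 | v <- l'].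
rewrite !big_map big_split/= big_const_seq count_predT iter_addr_0; apply.
  move=> t; rewrite !count_map.
  apply: (@minimal_cover_count _ T' _ _ l' s _ _ TT' adl adl' lmin)
    => w v lw lv /= tw [x [wx svx]].
  have [|A UA wA] := adl.2 _ T1 (translation a 1%g @` w); first by exists w.
  have Aw y : w y -> A y by move=> wy; apply: wA; exists y => //; exact: action1.
  have := TT' _ T1; rewrite mul1g => /(adl'.2) /(_ (translation a s @` v)).
  case=> [|B UB svB]; first by exists v.
  have [z vz _] := svx.
  rewrite (le_trans tw)// mulr2n addrA; apply: (@le_trans _ _ (f x + d)).
    by apply: (osc A) => //; apply: Aw => //; apply: ptP; exists x.
  rewrite lerD2r; apply: (osc B) => //; first exact: svB.
  by apply: svB; exists (pt v) => //; apply: ptP; exists z.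
by move=> _ /mapP[v _ ->]; rewrite addr_ge0// mulrn_wge0.
Qed.

End Covers.

(** * Consecutive ratios under zero exponential growth *)

Lemma slow_growth {R : realType} (c : nat -> \bar R) (q : R) :
    (forall n, 1 <= c n)%E ->
    (limn_esup (fun n => log2e (c n) * (n%:R^-1)%:E) <= 0)%E -> 1 < q ->
  exists2 n, (c n < +oo)%E & (c n.+1 <= q%:E * c n)%E.
Proof.
rewrite /log2e => c1 + q1.
have : 0 < ln (2 : R) by rewrite ln_gt0// ltr1n.
move: (ln 2) => L L0 limc; apply: contrapT => nc.
have lnq : 0 < ln q by rewrite ln_gt0.
(* Growth by the factor [q] at every step would force rate [ln q / L]; half of it is the
   threshold. *)
have : (limn_esup (fun n => lne (c n) * (L^-1)%:E * (n%:R^-1)%:E)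
        < (ln q / L / 2)%:E)%E.
  by rewrite (le_lt_trans limc)// lte_fin !divr_gt0.
case/ereal_inf_ltP => _ [V [N _ NV] <-] supV.
have cE n : (N < n)%N -> exists2 r, c n = r%:E & ln r *+ 2 < ln q *+ n.
  move=> Nn; have n0 : 0 < n%:R :> R by rewrite ltr0n (leq_trans _ Nn).
  have : (lne (c n) * (L^-1)%:E * (n%:R^-1)%:E < (ln q / L / 2)%:E)%E.
    apply: le_lt_trans supV; apply: ereal_sup_ubound; exists n => //.
    by apply: NV; exact: ltnW.
  have := c1 n; case: (c n) => [r||]//= r1.
    rewrite leNgt (lt_le_trans ltr01)//= -!EFinM lte_fin => lnr; exists r => //.
    have d0 : 0 < 2 * L * n%:R :> R by rewrite !mulr_gt0.
    move: lnr; rewrite -(ltr_pM2r d0) -mulr_natr -(mulr_natr (ln q)).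
    by congr (_ < _); field; rewrite ?gt_eqF.
  move=> +; rewrite gt0_mulye ?lte_fin ?invr_gt0//.
  by rewrite gt0_mulye ?lte_fin ?invr_gt0.
have growth k : exists2 r, c (N.+1 + k)%N = r%:E & q ^+ k <= r.
  elim: k => [|k [r cr qr]].
    have [r cr _] := cE N.+1 (ltnSn N).
    by exists r; rewrite ?addn0// -lee_fin -cr.
  have [r' cr' _] := cE (N.+1 + k.+1)%N (leq_addr _ _).
  exists r' => //; rewrite leNgt; apply/negP => r'q.
  apply: nc; exists (N.+1 + k)%N; first by rewrite cr ltry.
  rewrite -addnS cr' cr -EFinM lee_fin (le_trans (ltW r'q))// exprS.
  by rewrite ler_pM2l// (lt_trans ltr01).
(* At index [2 (N + 1)] the lower bound [q ^+ N.+1] meets the half-rate upper bound, a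
   contradiction. *)
have [r cr qr] := growth N.+1.
have [r' cr' lnr] := cE (N.+1 + N.+1)%N (leq_addr _ _).
move: lnr; have -> : r' = r by apply: EFin_inj; rewrite -cr' cr.
rewrite mulrnDr -mulr2n ltr_pMn2r// -lnXn ?(lt_trans ltr01)//.
have qN : 0 < q ^+ N.+1 by rewrite exprn_gt0// (lt_trans ltr01).
by rewrite ltNge ler_ln ?posrE ?(lt_le_trans qN)// qr.
Qed.

(** * Averages and almost invariant means *)

Section Average.
Context {R : realType} {X : topologicalType}.
Variable l : seq X.

Definition average (f : {ctsR X -> R}) : R := (size l)%:R^-1 * \sum_(x <- l) f x.

Lemma average_linear : scalar average.
Proof.
move=> c f g; rewrite /average mulrCA -mulrDr; congr (_ * _).
by rewrite mulr_sumr -big_split.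
Qed.

HB.instance Definition _ :=
  GRing.isLinear.Build R {ctsR X -> R} R *%R average average_linear.

Lemma average_is_mean : compact [set: X] -> (0 < size l)%N -> is_mean average.
Proof.
move=> cX l0 f.
have l0R : 0 < (size l)%:R :> R by rewrite ltr0n.
have nX : [set: X] !=set0 by case: l l0 => // x *; exists x.
have [M fM] := cts_bounded nX cX f.
have sumc c : \sum_(x <- l) c = c * (size l)%:R :> R.
  by rewrite big_const_seq count_predT iter_addr_0 mulr_natr.
rewrite /average ler_pdivlMl// ler_pdivrMl// mulrC -sumc mulrC -sumc.
apply/andP; split; apply: ler_sum => x _.
  apply: ge_inf; last by exists x.
  by exists (- M) => _ [y _ <-]; have := fM y; rewrite ler_norml => /andP[].
apply: ub_le_sup; last by exists x.
by exists M => _ [y _ <-]; have := fM y; rewrite ler_norml => /andP[].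
Qed.

End Average.

Section Means.
Context {R : realType} {G : topologicalGroupType} {X : topologicalType}.
Hypotheses (X_nonempty : [set: X] !=set0) (X_compact : compact [set: X]).
Variables (a : continuous_action G X) (S : set G).

Lemma covering_number_ge1 T U : (1 <= covering_number R a T U)%E.
Proof.
apply: le_ereal_inf_tmp => _ [V [[fV _ cV] _] <-].
rewrite lee_fin ler1n cardfs_gt0; apply/eqP => V0.
have [x _] := X_nonempty; have : [set: X] x by [].
by rewrite -cV => -[A VA _]; have := in_fset_set fV A; rewrite V0 mem_set.
Qed.

Lemma approximate_invariant_mean (F : seq {ctsR X -> R}) (e : R) :
    S 1%g -> (entropy R a S <= 0)%E -> 0 < e ->
  exists2 m : {scalar {ctsR X -> R}}, is_mean m &
    forall f s, f \in F -> S s -> `|m f - m (f \o translation a s)| <= e.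
Proof.
(* The sums over [l'] for [s] and for [1] are each within [3 d |l'|] of the same sum over [l],
   whence the 6. *)
move=> S1 S0 e0; pose d := e / 6.
have d0 : 0 < d by rewrite divr_gt0.
have [M M0 FM] := seq_cts_bounded X_nonempty X_compact F.
have [U oU oscU] := small_oscillation_cover X_nonempty X_compact F d d0.
pose c n := covering_number R a (set_expg S n) U.
(* The ratio [1 + d / M] makes [M (|l'| - |l|)] at most [d |l|]. *)
have [||n cn cSn] := @slow_growth R c (1 + d / M) (fun=> covering_number_ge1 _ _).
- by apply: le_trans S0; apply: ereal_sup_ubound; exists U.
- by rewrite ltrDl divr_gt0.
have cSny : (c n.+1 < +oo)%E.
  apply: le_lt_trans cSn _; rewrite -(fineK (x := c n)) ?ltry//.
  by rewrite ge0_fin_numE// (le_trans _ (covering_number_ge1 _ _)).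
have [l adl [cl lmin]] := minimal_cover _ _ _ cn.
have [l' adl' [cl' _]] := minimal_cover _ _ _ cSny.
have [x0 _] := X_nonempty; pose pt (A : set X) := xget x0 A.
have ptP A : A !=set0 -> A (pt A) by case=> x; exact: xgetI.
have l'0 : (0 < size l')%N.
  by have := covering_number_ge1 (set_expg S n.+1) U; rewrite cl' lee_fin ler1n.
have l'l : (size l')%:R <= (1 + d / M) * (size l)%:R :> R.
  by rewrite -lee_fin EFinM -cl -cl'.
have sumM (k : seq (set X)) : \sum_(i <- k) M = M * (size k)%:R :> R.
  by rewrite big_const_seq count_predT iter_addr_0 mulr_natr.
have l'M : (size l')%:R * M <= (size l)%:R * M + d * (size l)%:R :> R.
  rewrite -(ler_pM2r M0) in l'l; apply: (le_trans l'l).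
  by rewrite mulrAC mulrDl mul1r divfK ?gt_eqF// mulrDl mulrC.
have TT' s g : S s -> set_expg S n g -> set_expg S n.+1 (g * s)%g.
  by move=> Ss Tg; exact: set_expgSr.
have ll' : (size l)%:R <= (size l')%:R :> R.
  rewrite ler_nat -!count_predT.
  by apply: (minimal_cover_count _ _ _ _ (TT' 1%g ^~ S1) adl adl' lmin).
have {ll'}l'M : (size l')%:R * M <= (size l)%:R * M + d * (size l')%:R :> R.
  by rewrite (le_trans l'M)// lerD2l ler_pM2l.
have est f s : f \in F -> S s ->
  `|\sum_(w <- l) f (pt w) - \sum_(v <- l') f (translation a s (pt v))|
    <= 3 * d * (size l')%:R.
  move=> Ff Ss.
  have fM x : - M <= f x <= M by rewrite -ler_norml FM.
  have le_est h : (forall A x y, U A -> A x -> A y -> h x <= h y + d) ->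
      (forall x, 0 <= h x) ->
    \sum_(w <- l) h (pt w) <=
      \sum_(v <- l') h (translation a s (pt v)) + 2 * d * (size l')%:R.
    move=> hosc h0; rewrite mulr_natl mulr_natr.
    have T1 := set_expg1 _ n S1.
    exact: (sum_cover_le _ _ _ _ _ T1 (TT' s ^~ Ss) adl adl' lmin ptP
      hosc h0 (ltW d0)).
  (* The one-sided comparison needs nonnegative functions; applying it to both
     M - f and M + f gives the two bounds. *)
  have [fN fP] : (forall x, 0 <= M - f x) /\ (forall x, 0 <= M + f x).
    by split=> x; have := fM x; lra.
  have /le_est/(_ fN) leN A x y : U A -> A x -> A y -> M - f x <= M - f y + d.
    by move=> UA Ax Ay; have := oscU f A y x Ff UA Ay Ax; lra.
  have /le_est/(_ fP) leP A x y : U A -> A x -> A y -> M + f x <= M + f y + d.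
    by move=> UA Ax Ay; have := oscU f A x y Ff UA Ax Ay; lra.
  (* The constant [M] contributes [M (|l'| - |l|) <= d |l'|], on top of the [2 d |l'|] from
     oscillation. *)
  rewrite ler_norml; move: leN leP.
  by rewrite !big_split /= !sumM !sumrN; lra.
pose m : {scalar {ctsR X -> R}} := average [seq pt v | v <- l'].
exists m.
  by apply: average_is_mean; rewrite ?size_map.
move=> f s Ff Ss; rewrite /m /= /average size_map !big_map -mulrBr.
rewrite normrM ger0_norm ?invr_ge0// ler_pdivrMl ?ltr0n//.
have := est f 1%g Ff S1; have := est f s Ff Ss.
under [X in _ -> `|_ - X| <= _ -> _]eq_bigr do rewrite /translation action1.
rewrite !ler_norml /d /=.
lra.
Qed.

End Means.

(** * Ultrafilter limits of means and the invariant mean *)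

Lemma ultralimit_of_means {R : realType} {X : topologicalType}
    (F : set_system {scalar {ctsR X -> R}}) :
    [set: X] !=set0 -> compact [set: X] ->
    UltraFilter F -> (\forall m \near F, is_mean m) ->
  exists2 L : {scalar {ctsR X -> R}}, is_mean L &
    forall f, (fun m : {scalar {ctsR X -> R}} => m f : R^o) @ F --> (L f : R^o).
Proof.
move=> X_nonempty X_compact UF F_mean.
have PF : ProperFilter F by exact: ultra_proper.
pose ev f (m : {scalar {ctsR X -> R}}) : R^o := m f.
(* Means send [f] into [[- M, M]], so their values at [f] converge along [F]. *)
have ev_cvg f : ev f @ F --> lim (ev f @ F).
  have [M fM] := cts_bounded X_nonempty X_compact f.
  have rf0 : range f !=set0 by have [x _] := X_nonempty; exists (f x), x.
  apply: (ultra_cvg _ _ M UF); near=> m.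
  have /andP[lo hi] : inf (range f) <= m f <= sup (range f).
    by near: m; apply: filterS F_mean.
  rewrite ler_norml (le_trans _ lo) ?(le_trans hi)//.
    apply: ge_sup => // _ [x _ <-].
    by have := fM x; rewrite ler_norml => /andP[].
  apply: lb_le_inf => // _ [x _ <-].
  by have := fM x; rewrite ler_norml => /andP[].
have L_linear : scalar (fun f => lim (ev f @ F) : R).
  move=> c f g; apply: cvg_lim => //.
  have -> : ev (c *: f + g) = fun m => c * ev f m + ev g m.
    by apply/funext => m; exact: linearP.
  by apply: cvgD; [apply: cvgMr|]; exact: ev_cvg.
pose L : {scalar {ctsR X -> R}} := HB.pack (fun f => lim (ev f @ F) : R)
  (GRing.isLinear.Build R {ctsR X -> R} R *%R _ L_linear).
exists L; last exact: ev_cvg.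
move=> f; apply/andP; split.
  apply: (cvgr_to_ge (ev_cvg f)).
  by apply: filterS F_mean => m /(_ f) /andP[].
apply: (cvgr_to_le (ev_cvg f)).
by apply: filterS F_mean => m /(_ f) /andP[].
Unshelve. all: by end_near. Qed.

(** Induction on word length, peeling off the leftmost letter [u ord0]; [f] is generalized because
    the induction hypothesis is used at [f] composed with that letter's translation. *)
Lemma invariant_generating {R : realType} {G : topologicalGroupType}
    {X : topologicalType} (a : continuous_action G X) (S : set G)
    (m : {ctsR X -> R} -> R) :
    generating S -> (forall f s, S s -> m f = m (f \o translation a s)) ->
  action_invariant a m.
Proof.
move=> [_ genS] mS f g; have : [set: G] g by [].
rewrite genS => -[n _ [u Su <-]]; elim: n u Su f {g} => [|n IH] u Su f.
  rewrite big_ord0; congr m; apply/continuousEP => x /=.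
  by rewrite /translation action1.
rewrite big_ord_recl.
rewrite (mS f (u ord0))// (IH (fun i => u (lift ord0 i)))//; congr m.
by apply/continuousEP => x /=; rewrite /translation actionM.
Qed.

Theorem theorem4p4 (R : realType) (G : topologicalGroupType)
    (X : topologicalType) (X_nonempty : [set: X] !=set0)
    (X_compact : compact [set: X]) (X_hausdorff : hausdorff_space X)
    (a : continuous_action G X) (S : set G) (S_compact : compact S)
    (S_generating : generating S) (S_entropy : entropy R a S = 0%E) :
  amenable R a.
Proof.
have S1 : S 1%g by case: S_generating.
pose D := [set i : seq {ctsR X -> R} * R | 0 < i.2].
pose B (i : seq {ctsR X -> R} * R) := [set m : {scalar {ctsR X -> R}} |
  is_mean m /\ forall f s, f \in i.1 -> S s ->
    `|m f - m (f \o translation a s)| <= i.2].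
(* Concatenating the function lists and taking the smaller tolerance refines two conditions at
   once. *)
have filtB : Filter (filter_from D B).
  apply: filter_from_filter; first by exists ([::], 1); rewrite /D /=.
  move=> i j Di Dj; exists (i.1 ++ j.1, Num.min i.2 j.2).
    by rewrite /D /= lt_min; apply/andP.
  move=> m [mm mB]; split; split=> // f s fi Ss;
    have := mB f s; rewrite mem_cat fi ?orbT le_min => /(_ isT Ss) /andP[]//.
have properB : ProperFilter (filter_from D B).
  apply: filter_from_proper => -[F e] e0.
  have [|m mm mS] := approximate_invariant_mean X_nonempty X_compact a S F e S1 _ e0.
    by rewrite S_entropy.
  by exists m.
have [F [UF BF]] := ultraFilterLemma properB.
have FB F' e : 0 < e -> F (B (F', e)) by move=> e0; apply: BF; exists (F', e).
have Fmean : \forall m \near F, is_mean m.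
  by apply: filterS (FB [::] 1 ltr01) => m [].
have [L Lmean cvgL] := ultralimit_of_means F X_nonempty X_compact UF Fmean.
exists L; split=> //; apply: (invariant_generating _ _ _ S_generating) => f s Ss.
(* For each [e > 0], [F] contains the means that are [e]-invariant at [f], and this bound passes to
   the limit. *)
apply/eqP; rewrite -subr_eq0 -normr_le0; apply/ler_addgt0Pl => e e0; rewrite addr0.
apply: (cvgr_to_le (cvg_norm (cvgB (cvgL f) (cvgL (f \o translation a s))))).
apply: filterS (FB [:: f] e e0) => m [_]; apply => //.
exact: mem_head.
Qed.
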